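(* Let $R$ be a ring of the standard form below with generating character $\chi$. Define the partition $\mathcal H'=(P_m)_{m\in\mathcal M\cup\{\diamond\}}$ of $R$ by $P_\diamond=R\setminus\mathrm{soc}(R)$ and, for $m=(m_1,\dots,m_t)\in\mathcal M:=\{0,\dots,n_1\}\times\cdots\times\{0,\dots,n_t\}$, $P_m=\{(a_1,\dots,a_t)\in\mathrm{soc}(R):\mathrm{wt}(a_i)=m_i\ \forall i\}$ (discarding $P_\diamond$ if it is empty). Then the right $\chi$-dual partition of $\mathcal H'$ does not depend on $\chi$, coincides with the left $\chi$-dual partition, and equals $(Q_m)_{m\in\mathcal M\cup\{\diamond\}}$, where $Q_\diamond=\mathrm{rad}(R)\setminus\{0\}$, $Q_0=\{0\}$, and for $m\in\mathcal M\setminus\{0\}$, $$Q_m=\{(a_1,\dots,a_t)\in R\setminus\mathrm{rad}(R):\ \mathrm{wt}(a_i+\mathrm{rad}(R_i))=m_i\ \text{for all } i\}$$ (again discarding empty sets). In particular $\mathcal H'$ is reflexive. If $R=\mathrm{soc}(R)$, then $\mathcal H'$ has $s:=\prod_{i=1}^t(n_i+1)$ blocks, equals the product of the Hamming partitions on the $R_i$, and is self-dual; if $R\ne\mathrm{soc}(R)$, then $\mathcal H'$ has $s+1$ blocks.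
   Context: Standard form: $R=R_1\times\cdots\times R_t$ with $R_i=R_{i,1}\times\cdots\times R_{i,n_i}$, where each $R_{i,j}$ is a finite local Frobenius ring with $|R_{i,j}/\mathrm{rad}(R_{i,j})|=|\mathrm{soc}(R_{i,j})|=q_i$ for all $j$, and $q_1,\dots,q_t$ distinct ($\mathrm{rad}$ = Jacobson radical, $\mathrm{soc}$ = socle; $\mathrm{rad}(R)$ and $\mathrm{soc}(R)$ are the products of the components' radicals resp. socles). A finite ring is Frobenius if it admits a generating character, i.e. a character $\chi$ of its additive group such that $r\mapsto(x\mapsto\chi(xr))$ is a bijection onto the character group. For $a_i=(a_{i,1},\dots,a_{i,n_i})\in R_i$: $\mathrm{wt}(a_i)=|\{j:a_{i,j}\neq0\}|$ and $\mathrm{wt}(a_i+\mathrm{rad}(R_i))=|\{j:a_{i,j}\notin\mathrm{rad}(R_{i,j})\}|$. For a partition $\mathcal P$ of $R$, the right $\chi$-dual partition is given by $a\sim a'$ iff $\sum_{b\in P}\chi(ab)=\sum_{b\in P}\chi(a'b)$ for all blocks $P$ of $\mathcal P$; the left $\chi$-dual uses $\chi(ba)$. $\mathcal P$ is reflexive if the left $\chi$-dual of its right $\chi$-dual equals $\mathcal P$ (equivalently, $\mathcal P$ and its right $\chi$-dual have the same number of blocks), and self-dual if $\mathcal P$ equals its right $\chi$-dual. *)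

(* Defs.v *)
From HB Require Import structures.
From mathcomp Require Import all_boot all_order all_algebra all_field.
Unset Printing Implicit Defensive.
Import GRing.Theory.
Local Open Scope ring_scope.

Section FinRingNotions.
Variable A : finNzRingType.

Definition left_ideal (I : {set A}) : bool :=
  [&& (0 : A) \in I,
      [forall x, forall y, (x \in I) ==> (y \in I) ==> (x + y \in I)] &
      [forall r, forall x, (x \in I) ==> (r * x \in I)]].

Definition max_left_ideal (I : {set A}) : bool :=
  [&& left_ideal I, I != setT &
      [forall J : {set A}, (left_ideal J && (I \subset J)) ==> ((J == I) || (J == setT))]].

Definition min_left_ideal (I : {set A}) : bool :=
  [&& left_ideal I, I != [set 0] &
      [forall J : {set A}, (left_ideal J && (J \subset I)) ==> ((J == [set 0]) || (J == I))]].

Definition rad : {set A} :=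
  [set x | [forall I : {set A}, max_left_ideal I ==> (x \in I)]].

(* (left) socle = sum of all minimal left ideals, i.e. the smallest left ideal
   containing all minimal left ideals *)
Definition soc : {set A} :=
  [set x | [forall I : {set A},
     (left_ideal I && [forall J : {set A}, min_left_ideal J ==> (J \subset I)])
       ==> (x \in I)]].

Definition local_ring : bool := #|[set I : {set A} | max_left_ideal I]| == 1%N.

Definition card_quot_rad : nat := #|[set [set y : A | x - y \in rad] | x : A]|.

End FinRingNotions.

Definition is_add_char (T : finType) (add : T -> T -> T) (psi : T -> algC) : Prop :=
  (forall x, psi x != 0) /\ (forall x y, psi (add x y) = psi x * psi y).

Definition generating_char (T : finType) (add mul : T -> T -> T) (chi : T -> algC) : Prop :=
  [/\ is_add_char T add chi,
      (forall r r', (forall x, chi (mul x r) = chi (mul x r')) -> r = r') &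
      (forall psi, is_add_char T add psi -> exists r, forall x, psi x = chi (mul x r))].

Definition frobenius (A : finNzRingType) : Prop :=
  exists chi : A -> algC, generating_char A +%R *%R chi.

Section Product.
Variables (t : nat) (n : 'I_t -> nat) (Rf : forall i : 'I_t, 'I_(n i) -> finNzRingType).

Definition Ri (i : 'I_t) := {dffun forall j : 'I_(n i), Rf i j}.
Definition Rprod := {dffun forall i : 'I_t, Ri i}.

Definition addR (a b : Rprod) : Rprod :=
  [ffun i => ([ffun j => (a i j + b i j : Rf i j)] : Ri i)].
Definition mulR (a b : Rprod) : Rprod :=
  [ffun i => ([ffun j => (a i j * b i j : Rf i j)] : Ri i)].
Definition zeroR : Rprod := [ffun i => ([ffun j => (0 : Rf i j)] : Ri i)].

Definition radR : {set Rprod} := [set a : Rprod | [forall i, forall j, a i j \in rad (Rf i j)]].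
Definition socR : {set Rprod} := [set a : Rprod | [forall i, forall j, a i j \in soc (Rf i j)]].

Definition wt (i : 'I_t) (a : Ri i) : nat := #|[set j | a j != 0]|.
Definition wtbar (i : 'I_t) (a : Ri i) : nat := #|[set j | a j \notin rad (Rf i j)]|.

Definition Mset := {dffun forall i : 'I_t, 'I_(n i).+1}.
Definition m_nonzero (m : Mset) : bool := [exists i, (m i != 0 :> nat)].

Definition Pblock (m : Mset) : {set Rprod} :=
  [set a in socR | [forall i, wt i (a i) == m i]].
Definition Pdiamond : {set Rprod} := ~: socR.
Definition Hpart : {set {set Rprod}} := (Pdiamond |: [set Pblock m | m : Mset]) :\ set0.

Definition Qblock (m : Mset) : {set Rprod} :=
  [set a in ~: radR | [forall i, wtbar i (a i) == m i]].
Definition Qdiamond : {set Rprod} := radR :\ zeroR.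
Definition Qpart : {set {set Rprod}} :=
  (Qdiamond |: ([set zeroR] |: [set Qblock m | m in [pred m | m_nonzero m]])) :\ set0.

Definition rdual (chi : Rprod -> algC) (P : {set {set Rprod}}) : {set {set Rprod}} :=
  equivalence_partition
    (fun a a' => [forall B in P, \sum_(b in B) chi (mulR a b) == \sum_(b in B) chi (mulR a' b)])
    [set: Rprod].
Definition ldual (chi : Rprod -> algC) (P : {set {set Rprod}}) : {set {set Rprod}} :=
  equivalence_partition
    (fun a a' => [forall B in P, \sum_(b in B) chi (mulR b a) == \sum_(b in B) chi (mulR b a')])
    [set: Rprod].

Definition reflexive_part (chi : Rprod -> algC) (P : {set {set Rprod}}) : Prop :=
  ldual chi (rdual chi P) = P.
Definition self_dual (chi : Rprod -> algC) (P : {set {set Rprod}}) : Prop :=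
  rdual chi P = P.

Definition hamming (i : 'I_t) : {set {set Ri i}} :=
  [set [set a : Ri i | wt i a == k] | k : 'I_(n i).+1].
Definition Bfam := {dffun forall i : 'I_t, {set Ri i}}.
Definition prod_hamming : {set {set Rprod}} :=
  [set [set a : Rprod | [forall i, a i \in (f : Bfam) i]] | f in [pred f : Bfam | [forall i, f i \in hamming i]]].

End Product.

(* Main.v *)
From HB Require Import structures.
From mathcomp Require Import all_boot all_order all_algebra all_field.
Require Import Defs.
Set Implicit Arguments.
Unset Strict Implicit.
Unset Printing Implicit Defensive.
Import Order.TTheory GRing.Theory Num.Theory.
Local Open Scope ring_scope.

(** Over a local component with residue field of size [q], the socle is the
    annihilator of the radical on both sides and elements outside the radical
    are units, so the sum of [chi (a b)] over the nonzero [b] of the socle is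
    [q - 1] or [-1] according to whether [a] lies in the radical. Distributing
    over the components, the sum of [chi (a b)] over [P_m] is the product over
    [i] of the coefficient of degree [m_i] of the Krawtchouk polynomial
    [(1 + (q_i - 1) X)^(n_i - w_i) (1 - X)^(w_i)], where [w_i] is the weight of
    [a_i] modulo the radical. The coefficients of degree 1 recover the [w_i],
    and the sum over all of [R] recovers whether [a = 0]. The sums over the
    blocks [Q_m], which are unions of cosets of the radical, vanish for [a]
    outside the socle and otherwise give the same polynomials, up to a factor,
    in the weights of [a]; hence the left dual brings back the partition. *)

(** * Left ideals of a finite ring *)

Section LeftIdeals.
Variable A : finNzRingType.
Implicit Types (I J : {set A}) (a r x y : A).

Lemma left_idealP I :
  reflect [/\ 0 \in I, forall x y, x \in I -> y \in I -> x + y \in I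
            & forall r x, x \in I -> r * x \in I]
          (left_ideal A I).
Proof.
apply: (iffP and3P) => -[I0 ID IM]; split=> //.
- by move=> x y Ix Iy; move/forallP/(_ x)/forallP/(_ y): ID; rewrite Ix Iy.
- by move=> r x Ix; move/forallP/(_ r)/forallP/(_ x): IM; rewrite Ix.
- apply/forallP=> x; apply/forallP=> y; apply/implyP=> Ix; apply/implyP=> Iy.
  exact: ID.
- by apply/forallP=> r; apply/forallP=> x; apply/implyP=> Ix; apply: IM.
Qed.

Lemma left_idealB I x y : left_ideal A I -> x \in I -> y \in I -> x - y \in I.
Proof. by case/left_idealP=> _ ID IM Ix Iy; rewrite -[y]mul1r -mulNr ID ?IM. Qed.

Lemma left_ideal_eqT I : left_ideal A I -> 1 \in I -> I = setT.
Proof.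
case/left_idealP=> _ _ IM I1; apply/setP=> x.
by rewrite inE -[x]mulr1 IM.
Qed.

Lemma mem_principal r a : r * a \in [set s * a | s in A].
Proof. by apply/imsetP; exists r. Qed.

Lemma principal_id a : a \in [set s * a | s in A].
Proof. by rewrite -{1}[a]mul1r mem_principal. Qed.

Lemma left_ideal_principal a : left_ideal A [set r * a | r in A].
Proof.
apply/left_idealP; split.
- by rewrite -(mul0r a) mem_principal.
- by move=> _ _ /imsetP[r _ ->] /imsetP[s _ ->]; rewrite -mulrDl mem_principal.
- by move=> s _ /imsetP[r _ ->]; rewrite mulrA mem_principal.
Qed.

Lemma max_left_ideal_above I :
  left_ideal A I -> I != setT -> exists2 M, max_left_ideal A M & I \subset M.
Proof.
move=> lI pI.
have [|M /maxsetP[/andP[lM pM] maxM] sIM] :=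
  @maxset_exists _ (fun J => left_ideal A J && (J != setT)) I.
  exact/andP.
exists M => //; apply/and3P; split=> //; apply/forallP=> J; apply/implyP.
case/andP=> lJ sMJ; case: (eqVneq J setT) => [|pJ]; first by rewrite orbT.
by rewrite (maxM J) ?eqxx ?lJ.
Qed.

Lemma min_left_idealP I :
  reflect [/\ left_ideal A I, I != [set 0] &
            forall J, left_ideal A J -> J \subset I -> J = [set 0] \/ J = I]
          (min_left_ideal A I).
Proof.
apply: (iffP and3P) => -[lI nI mI]; split=> //.
- move=> J lJ sJ; move/forallP/(_ J): mI; rewrite lJ sJ /=.
  by case/orP=> /eqP; [left|right].
- apply/forallP=> J; apply/implyP=> /andP[lJ sJ].
  by case: (mI J lJ sJ) => ->; rewrite eqxx ?orbT.
Qed.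

(** Left multiplication by [x] is injective, hence bijective by finiteness; the preimage of 1 is a
    right inverse of [x] and must equal [y]. *)
Lemma left_inv_right_inv x y : y * x = 1 -> x * y = 1.
Proof.
move=> yx; have inj_x : injective (fun z => x * z).
  by move=> z z' /(congr1 ( *%R y)); rewrite !mulrA yx !mul1r.
have [g _ gK] := injF_bij inj_x.
have xg := gK 1; rewrite /= in xg.
by rewrite -[y]mulr1 -xg [y * _]mulrA yx mul1r.
Qed.

End LeftIdeals.

(** * Radical and socle of a finite local ring *)

Section LocalRing.
Variable A : finNzRingType.
Hypothesis locA : local_ring A.
Implicit Types (I J : {set A}) (a r x y : A).

Lemma local_max_left_ideal I : max_left_ideal A I = (I == rad A).
Proof.
have /cards1P[M defM] := locA.
have maxE J : max_left_ideal A J = (J == M).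
  by have /setP/(_ J) := defM; rewrite !inE.
suff -> : rad A = M by [].
apply/setP=> x; rewrite inE; apply/forallP/idP => [/(_ M)|Mx J].
  by rewrite maxE eqxx.
by rewrite maxE; apply/implyP=> /eqP->.
Qed.

Lemma rad_left_ideal : left_ideal A (rad A).
Proof. by have := local_max_left_ideal (rad A); rewrite eqxx => /and3P[]. Qed.

Lemma rad_neqT : rad A != setT.
Proof. by have := local_max_left_ideal (rad A); rewrite eqxx => /and3P[]. Qed.

Lemma rad0 : 0 \in rad A.
Proof. by have /left_idealP[] := rad_left_ideal. Qed.

Lemma radD x y : x \in rad A -> y \in rad A -> x + y \in rad A.
Proof. by have /left_idealP[_ + _] := rad_left_ideal; apply. Qed.

Lemma radMl r x : x \in rad A -> r * x \in rad A.
Proof. by have /left_idealP[_ _ +] := rad_left_ideal; apply. Qed.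

Lemma radB x y : x \in rad A -> y \in rad A -> x - y \in rad A.
Proof. exact: left_idealB rad_left_ideal. Qed.

Lemma rad_one : 1 \notin rad A.
Proof. by apply: contra rad_neqT => r1; rewrite (left_ideal_eqT rad_left_ideal). Qed.

(** If the left ideal generated by [x] were proper, it would lie in the only maximal left ideal,
    which is the radical. *)
Lemma notin_rad_inv x : x \notin rad A -> exists y, y * x = 1 /\ x * y = 1.
Proof.
move=> nx; suff /eqP/setP/(_ 1) : [set r * x | r in A] == setT.
  rewrite inE => /imsetP[y _ /esym yx]; exists y; split=> //.
  exact: left_inv_right_inv.
apply: contraR nx => /(max_left_ideal_above (left_ideal_principal x))[M].
rewrite local_max_left_ideal => /eqP-> /subsetP; apply.
exact: principal_id.
Qed.

(** If [x * r] were a unit, [x] would have a right inverse, which is also a left inverse, and 1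
    would be in the left ideal [rad A]. *)
Lemma radMr r x : x \in rad A -> x * r \in rad A.
Proof.
move=> rx; apply/negPn/negP=> /notin_rad_inv[y [_]]; rewrite -mulrA.
move/left_inv_right_inv=> rx1; case/negP: rad_one.
by rewrite -rx1 radMl.
Qed.

Lemma sub1_rad_inv x : x \in rad A -> exists y, y * (1 - x) = 1.
Proof.
move=> rx; have [|y [yx _]] := @notin_rad_inv (1 - x); last by exists y.
by apply: contra rad_one => rx1; rewrite -(subrK x 1) radD.
Qed.

(* A nonzero [r * a] has [r] outside the radical, hence [r] is a unit and
   [r * a] generates the same left ideal as [a]. *)
Lemma principal_minimal a :
  a != 0 -> {in rad A, forall x, x * a = 0} ->
  min_left_ideal A [set r * a | r in A].
Proof.
move=> a0 ra; apply/min_left_idealP; split; first exact: left_ideal_principal.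
  apply: contra a0 => /eqP/setP/(_ a).
  by rewrite !inE principal_id => <-.
move=> J lJ sJ; have [J0|] := boolP (J \subset [set 0]).
  left; apply/eqP; rewrite eqEsubset J0 sub1set.
  by case/left_idealP: lJ.
case/subsetPn=> b Jb; rewrite inE => b0; right; apply/eqP.
rewrite eqEsubset sJ; apply/subsetP=> _ /imsetP[s _ ->].
case/left_idealP: lJ => _ _ JM; apply: (JM).
have /imsetP[r _ bE] := subsetP sJ b Jb.
have [|y [yr _]] := @notin_rad_inv r.
  by apply: contra b0; rewrite bE => /ra->.
by rewrite -[a]mul1r -yr -mulrA -bE JM.
Qed.

(** The right annihilator of the radical is a left ideal, and it contains every minimal left ideal
    by a Nakayama argument. Conversely a nonzero element of it generates a minimal left ideal. *)
Lemma socP a : reflect {in rad A, forall x, x * a = 0} (a \in soc A).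
Proof.
rewrite inE; apply: (iffP forallP) => [|ra I]; last first.
  apply/implyP=> /andP[/left_idealP[I0 _ _] /forallP mI].
  have [->//|a0] := eqVneq a 0.
  move/implyP: (mI [set r * a | r in A]) => /(_ (principal_minimal a0 ra)).
  by move/subsetP; apply; apply: principal_id.
move/(_ [set b | [forall x in rad A, x * b == 0]]).
have -> : left_ideal A [set b | [forall x in rad A, x * b == 0]].
  apply/left_idealP; split.
  - by rewrite inE; apply/forall_inP=> x _; rewrite mulr0.
  - move=> b c; rewrite !inE => /forall_inP rb /forall_inP rc.
    apply/forall_inP=> x rx.
    by rewrite mulrDr (eqP (rb x rx)) (eqP (rc x rx)) addr0.
  - move=> r b; rewrite !inE => /forall_inP rb.
    by apply/forall_inP=> x rx; rewrite mulrA rb ?radMr.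
rewrite inE /= => /implyP mI x rx; apply/eqP; apply: (forall_inP (mI _)) rx.
apply/forallP=> J; apply/implyP=> /min_left_idealP[lJ J0 mJ].
apply/subsetP=> b Jb; rewrite inE; apply/forall_inP=> y ry.
apply/eqP; apply: contraTeq Jb => yb0.
have JM : forall r c, c \in J -> r * c \in J by case/left_idealP: lJ.
apply/negP=> Jb.
(* If [y * b] is nonzero, minimality makes it generate [J], so [b = r * (y * b)] for some [r]; as
   [1 - r * y] is a unit, [b = 0]. *)
have [||/setP/(_ (y * b))|JE] := mJ [set r * (y * b) | r in A].
- exact: left_ideal_principal.
- by apply/subsetP=> _ /imsetP[r _ ->]; rewrite !JM.
- by rewrite inE (negPf yb0) principal_id.
have := Jb; rewrite -JE => /imsetP[r _ bE].
have [z z1] := sub1_rad_inv (radMl r ry).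
case/eqP: yb0; suff -> : b = 0 by rewrite mulr0.
by rewrite -[b]mul1r -z1 -mulrA mulrBl mul1r -mulrA -bE subrr mulr0.
Qed.

Lemma soc0 : 0 \in soc A.
Proof. by apply/socP=> x _; rewrite mulr0. Qed.

Lemma rad_soc x a : x \in rad A -> a \in soc A -> x * a = 0.
Proof. by move=> rx /socP->. Qed.

Lemma socMl r a : a \in soc A -> r * a \in soc A.
Proof. by move=> sa; apply/socP=> x rx; rewrite mulrA rad_soc ?radMr //. Qed.

Lemma socMr r a : a \in soc A -> a * r \in soc A.
Proof. by move=> sa; apply/socP=> x rx; rewrite mulrA (rad_soc rx sa) mul0r. Qed.

Lemma socD a b : a \in soc A -> b \in soc A -> a + b \in soc A.
Proof. by move=> sa sb; apply/socP=> x rx; rewrite mulrDr !rad_soc ?addr0. Qed.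

(** By the pigeonhole principle two powers with exponents [k < l] coincide, so
    [x ^+ k * (1 - x ^+ (l - k)) = 0], where the second factor is a unit. *)
Lemma rad_nilpotent x : x \in rad A -> exists k, x ^+ k = 0.
Proof.
move=> rx; pose f (k : 'I_#|A|.+1) := x ^+ k.
have /injectivePn[k [l kl fkl]] : ~~ injectiveb f.
  by apply/injectiveP=> /leq_card; rewrite card_ord ltnn.
wlog lt_kl : k l kl fkl / (k < l)%N.
  move=> W; case: (ltngtP k l) => [|lk|/val_inj kE]; first exact: W.
    by apply: (W l k) => //; rewrite eq_sym.
  by rewrite kE eqxx in kl.
exists k; rewrite /f -(subnKC lt_kl) addSnnS exprD exprSr in fkl.
have [y y1] := sub1_rad_inv (radMl (x ^+ (l - k.+1)) rx).
have x1 := left_inv_right_inv y1.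
by rewrite -[x ^+ k]mulr1 -x1 mulrA mulrBr mulr1 -fkl subrr mul0r.
Qed.

(** The left annihilator of a nonzero socle element is exactly the radical, so the fibers of
    [r |-> r * a] are the cosets of the radical. *)
Lemma card_quot_rad_principal a : a != 0 -> a \in soc A ->
  card_quot_rad A = #|[set r * a | r in A]|.
Proof.
move=> a0 sa; rewrite /card_quot_rad.
have ann r : (r * a == 0) = (r \in rad A).
  apply/eqP/idP => [ra|]; last by move/rad_soc->.
  apply: contraTT isT => /notin_rad_inv[y [yr _]].
  by case/eqP: a0; rewrite -[a]mul1r -yr -mulrA ra mulr0.
have cE x : [set r | r * a == x * a] = [set y | x - y \in rad A].
  by apply/setP=> y; rewrite [LHS]inE [RHS]inE -ann mulrBl subr_eq0 eq_sym.
have -> : [set [set y | x - y \in rad A] | x : A] =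
          [set [set r | r * a == c] | c in [set r * a | r in A]].
  rewrite -imset_comp; apply: eq_imset => x; exact/esym/cE.
rewrite card_in_imset // => _ _ /imsetP[r _ ->] /imsetP[s _ ->] /setP/(_ r).
by rewrite !inE eqxx => /esym/eqP.
Qed.

Lemma card_rad_quot : (card_quot_rad A * #|rad A|)%N = #|A|.
Proof.
rewrite -cardsT.
pose E x y := x - y \in rad A.
have eqE : {in [set: A] & &, equivalence_rel E}.
  move=> x y z _ _ _; rewrite /E subrr rad0; split=> // xy.
  apply/idP/idP => [xz|yz]; last by rewrite -(subrKA y) radD.
  by rewrite -[y - z](subrKA x) radD // -opprB -sub0r radB ?rad0.
have partE := equivalence_partitionP eqE.
have -> : card_quot_rad A = #|equivalence_partition E [set: A]|.
  apply: eq_card => B; apply/imsetP/imsetP=> -[x _ ->]; exists x => //;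
  by apply/setP=> y; rewrite [LHS]inE [RHS]inE ?in_setT.
(* Lagrange's count: each class is the image of [rad A] under the injection [z |-> x - z]. *)
rewrite (@card_uniform_partition _ #|rad A| _ _ _ partE) // => B.
case/imsetP=> x _ ->; rewrite -(card_imset _ (subrI x)).
apply: eq_card => y; apply/imsetP/idP => [[z + ->]|ry].
  by rewrite inE => /andP[].
by exists (x - y); rewrite ?subKr // inE in_setT /E subKr.
Qed.

Lemma card_quot_rad_gt1 : (1 < card_quot_rad A)%N.
Proof.
rewrite /card_quot_rad (cardsD1 [set y | 0 - y \in rad A]) imset_f //.
rewrite (cardsD1 [set y | 1 - y \in rad A]) !inE imset_f // andbT.
rewrite (_ : _ != _) //; apply/eqP=> /setP/(_ 1).
rewrite [LHS]inE [RHS]inE subrr rad0 sub0r => /esym/(radMl (-1)).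
by rewrite mulrNN mulr1; apply/negP/rad_one.
Qed.

Hypothesis card_soc : #|soc A| = card_quot_rad A.

Lemma soc_neq0 : exists2 a, a \in soc A & a != 0.
Proof.
apply/exists_inP; apply: contraTT card_quot_rad_gt1 => /exists_inPn s0.
rewrite -card_soc -leqNgt -(cards1 (0 : A)) subset_leq_card //.
by apply/subsetP=> x /s0; rewrite inE negbK.
Qed.

(** The left ideal generated by [a] already has as many elements as the residue field, hence as the
    socle containing it. *)
Lemma soc_principal a : a != 0 -> a \in soc A -> soc A = [set r * a | r in A].
Proof.
move=> a0 sa; apply/esym/eqP; rewrite eqEcard card_soc.
rewrite (card_quot_rad_principal a0 sa) leqnn andbT.
by apply/subsetP=> _ /imsetP[r _ ->]; rewrite socMl.
Qed.

(* Otherwise [a x = u a] with [u] a unit, hence [a x^k = u^k a] for all [k],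
   against the nilpotency of [x]. *)
Lemma soc_rad a x : a \in soc A -> x \in rad A -> a * x = 0.
Proof.
move=> sa rx; apply: contraTeq isT => ax0.
have a0 : a != 0 by apply: contra ax0 => /eqP->; rewrite mul0r.
have := socMr x sa; rewrite (soc_principal a0 sa) => /imsetP[u _ axE].
have [|v [vu _]] := @notin_rad_inv u.
  by apply: contra ax0 => ru; rewrite axE rad_soc.
have axk k : a = v ^+ k * (a * x ^+ k).
  elim: k => [|k IHk]; first by rewrite !expr0 mul1r mulr1.
  rewrite exprSr exprS [a * _]mulrA axE -[u * a * _]mulrA -[RHS]mulrA.
  by rewrite [v * _]mulrA vu mul1r.
have [k xk] := rad_nilpotent rx.
by case/eqP: a0; rewrite (axk k) xk !mulr0.
Qed.

End LocalRing.

(** * Character sums over a local ring, its socle and its radical *)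

Section CharacterSums.
Variable A : finNzRingType.

(** Translation by [y] permutes [I] and multiplies the sum by [f y], which differs from 1. *)
Lemma sum_char_eq0 (f : A -> algC) (I : {set A}) y :
  (forall x z, f (x + z) = f x * f z) -> zmod_closed I ->
  y \in I -> f y != 1 -> \sum_(x in I) f x = 0.
Proof.
move=> fD [I0 subI] Iy fy1.
have IB x z : x \in I -> z \in I -> x - z \in I by exact: subI.
have IN z : (z \in I) -> - z \in I by move=> Iz; rewrite -sub0r IB.
have : \sum_(x in I) f x = (\sum_(x in I) f x) * f y.
  rewrite [LHS](reindex_inj (addIr y)) big_distrl /=; apply: eq_big => [x|x _].
    apply/idP/idP => [Ixy|Ix]; last first.
      by rewrite -[y]opprK IB ?IN.
    by have := IB _ _ Ixy Iy; rewrite addrK.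
  exact: fD.
move/eqP; rewrite -subr_eq0 -{1}[\sum_(x in I) f x]mulr1 -mulrBr mulf_eq0.
by rewrite subr_eq0 [1 == _]eq_sym (negPf fy1) orbF => /eqP.
Qed.

Lemma sum_char_eq0T (f : A -> algC) y :
  (forall x z, f (x + z) = f x * f z) -> f y != 1 -> \sum_x f x = 0.
Proof.
move=> fD fy1; rewrite -(eq_bigl _ _ (in_setT (T := A))).
by apply: sum_char_eq0 fy1 => //; split=> [|x z _ _]; apply: in_setT.
Qed.

Variable psi : A -> algC.
Hypothesis psiD : forall x y, psi (x + y) = psi x * psi y.
Hypothesis psi_neq0 : forall x, psi x != 0.
Hypothesis psi_nondeg : forall r, (forall x, psi (x * r) = 1) -> r = 0.

Lemma psi0 : psi 0 = 1.
Proof.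
by apply: (mulIf (psi_neq0 0)); rewrite -psiD addr0 mul1r.
Qed.

Lemma psi_nondegP r : r != 0 -> exists x, psi (x * r) != 1.
Proof.
move=> r0; apply/existsP; apply: contraNT r0 => /existsPn h.
by apply/eqP/psi_nondeg => x; apply/eqP; rewrite -[_ == _]negbK h.
Qed.

Lemma sum_charMr r : \sum_x psi (x * r) = if r == 0 then #|A|%:R else 0.
Proof.
case: eqVneq => [->|r0].
  under eq_bigr do rewrite mulr0 psi0; by rewrite sumr_const.
have [y y1] := psi_nondegP r0.
apply: (sum_char_eq0T (f := fun x => psi (x * r))) y1.
by move=> x z; rewrite mulrDl psiD.
Qed.

(* Evaluating the sum of all [psi (a * b)] in both orders shows that as many
   elements are degenerate on the left as on the right. *)
Lemma psi_nondegl r : (forall x, psi (r * x) = 1) -> r = 0.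
Proof.
pose N := [set a | [forall x, psi (a * x) == 1]].
have row a : \sum_b psi (a * b) = (a \in N)%:R * #|A|%:R.
  rewrite inE; case: forallP => [h|/forallP].
    by under eq_bigr do rewrite (eqP (h _)); rewrite sumr_const mul1r.
  rewrite mul0r => /forallPn[y y1].
  apply: (sum_char_eq0T (f := fun x => psi (a * x))) y1.
  by move=> x z; rewrite mulrDr psiD.
have NE : #|N|%:R * #|A|%:R = #|A|%:R :> algC.
  rewrite -sum1_card natr_sum mulr_suml big_mkcond /=.
  transitivity (\sum_a \sum_b psi (a * b)).
    apply: eq_bigr => a _; rewrite row.
    by case: (a \in N); rewrite ?mul0r.
  rewrite exchange_big /= (bigD1 0) //= sum_charMr eqxx big1 ?addr0 // => b b0.
  by rewrite sum_charMr (negPf b0).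
have cardA0 : #|A|%:R != 0 :> algC.
  by rewrite pnatr_eq0 -lt0n; apply/card_gt0P; exists 0.
have : #|N| == 1%N.
  by rewrite -(eqr_nat algC); apply/eqP/(mulIf cardA0); rewrite NE mul1r.
case/cards1P=> a NEa rx.
have : 0 \in N by rewrite inE; apply/forallP=> x; rewrite mul0r psi0.
have : r \in N by rewrite inE; apply/forallP=> x; rewrite rx.
by rewrite NEa !inE => /eqP-> /eqP.
Qed.

Lemma sum_charMl r : \sum_x psi (r * x) = if r == 0 then #|A|%:R else 0.
Proof.
case: eqVneq => [->|r0].
  under eq_bigr do rewrite mul0r psi0; by rewrite sumr_const.
have [y y1] : exists x, psi (r * x) != 1.
  apply/existsP; apply: contraNT r0 => /existsPn h.
  by apply/eqP/psi_nondegl => x; apply/eqP; rewrite -[_ == _]negbK h.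
apply: (sum_char_eq0T (f := fun x => psi (r * x))) y1.
by move=> x z; rewrite mulrDr psiD.
Qed.

Hypothesis locA : local_ring A.
Variable q : nat.
Hypothesis card_quot : card_quot_rad A = q.
Hypothesis card_soc : #|soc A| = q.

Let card_socE : #|soc A| = card_quot_rad A.
Proof. by rewrite card_soc. Qed.

Let soc_zmod_closed : zmod_closed (soc A).
Proof.
split=> [|x y sx sy]; first exact: soc0.
by rewrite -[y]mul1r -mulNr socD ?socMl.
Qed.

Let rad_zmod_closed : zmod_closed (rad A).
Proof. by split=> [|x y]; [exact: rad0 | exact: radB]. Qed.

(** For [a] in the radical all terms are 1. Otherwise [a] is a unit, and a socle element [x * s] on
    which [psi] is not 1 is reached as [a] times the socle element [v * (x * s)]. *)
Lemma sum_char_socMl a :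
  \sum_(b in soc A) psi (a * b) = if a \in rad A then q%:R else 0.
Proof.
case: ifPn => [ra|nra].
  rewrite -card_soc -sumr_const; apply: eq_bigr => b sb.
  by rewrite rad_soc // psi0.
have [s ss s0] := soc_neq0 locA card_socE.
have [x x1] := psi_nondegP s0; have [v [_ av]] := notin_rad_inv locA nra.
apply: (sum_char_eq0 (f := fun b => psi (a * b)) (y := v * (x * s))) => //.
- by move=> y z; rewrite mulrDr psiD.
- by rewrite !socMl.
- by rewrite [a * _]mulrA av mul1r.
Qed.

Lemma sum_char_socMr a :
  \sum_(b in soc A) psi (b * a) = if a \in rad A then q%:R else 0.
Proof.
case: ifPn => [ra|nra].
  rewrite -card_soc -sumr_const; apply: eq_bigr => b sb.
  by rewrite (soc_rad locA card_socE) // psi0.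
have [s ss s0] := soc_neq0 locA card_socE.
have [x x1] := psi_nondegP s0; have [v [va _]] := notin_rad_inv locA nra.
apply: (sum_char_eq0 (f := fun b => psi (b * a)) (y := x * s * v)) => //.
- by move=> y z; rewrite mulrDl psiD.
- by rewrite socMr ?socMl.
- by rewrite /= -mulrA va mulr1.
Qed.

(** Outside the socle, [a] has a nonzero multiple [r * a] with [r] in the radical; nondegeneracy
    then gives an [x] with [psi (x * r * a)] different from 1, and [x * r] is still in the
    radical. *)
Lemma sum_char_radMr a :
  \sum_(b in rad A) psi (b * a) = if a \in soc A then #|rad A|%:R else 0.
Proof.
case: ifPn => [sa|nsa].
  rewrite -sumr_const; apply: eq_bigr => b rb.
  by rewrite rad_soc // psi0.
have [r rr ra0] : exists2 r, r \in rad A & r * a != 0.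
  apply/exists_inP; apply: contraR nsa => /exists_inPn h.
  by apply/(socP locA) => x rx; apply/eqP; rewrite -[_ == _]negbK h.
have [x x1] := psi_nondegP ra0.
apply: (sum_char_eq0 (f := fun b => psi (b * a)) (y := x * r)) => //.
- by move=> y z; rewrite mulrDl psiD.
- by rewrite radMl.
- by rewrite /= -mulrA.
Qed.

(** This is the sum over the ring minus the sum over the radical. The factor [q - 1] at [a = 0]
    comes from the ring having [q] cosets of the radical. *)
Lemma sum_char_radCMr a :
  \sum_(b | b \notin rad A) psi (b * a) =
  if a \in soc A then #|rad A|%:R * (if a == 0 then q%:R - 1 else -1) else 0.
Proof.
have -> : \sum_(b | b \notin rad A) psi (b * a) =
  \sum_b psi (b * a) - \sum_(b in rad A) psi (b * a).
  by rewrite [X in _ = X - _](bigID (mem (rad A))) /= addrAC subrr add0r.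
rewrite sum_charMr sum_char_radMr -(card_rad_quot locA) card_quot.
case: (boolP (a \in soc A)) => sa; case: (a =P 0) => a0.
- by rewrite natrM mulrBr mulr1 [_ * q%:R]mulrC.
- by rewrite sub0r mulrN1.
- by rewrite a0 soc0 in sa.
- by rewrite subr0.
Qed.

End CharacterSums.

(** * Distributivity and cardinality for dependent products *)

Lemma bigA_distr_dffun (R : comPzSemiRingType) (I : finType) (T_ : I -> finType)
    (F : forall i, T_ i -> R) :
  \prod_i \sum_(x : T_ i) F i x =
  \sum_(f : {dffun forall i, T_ i}) \prod_i F i (f i).
Proof.
rewrite (reindex (@dffun_of_fprod I T_)); last exact/onW_bij/dffun_of_fprod_bij.
transitivity (\sum_(f : fprod T_) \prod_i [ffun x => F i x] (f i)); last first.
  by apply: eq_bigr => f _; apply: eq_bigr => i _; rewrite !ffunE.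
(* Dependent families become functions into the tagged sum type, where nondependent distributivity
   applies. *)
rewrite (big_fprod _ _ (fun i => [ffun x => F i x])).
under eq_bigr => i _ do rewrite (big_tag F).
rewrite bigA_distr_big_dep; apply: eq_big => [f|f _].
  by apply/familyP/familyP => h i; have := h i; rewrite !inE.
apply: eq_bigr => i _; rewrite /untag; case: eqP => // e.
by rewrite ffunE.
Qed.

Lemma card_dffun (I : finType) (T_ : I -> finType) :
  #|{dffun forall i, T_ i}| = (\prod_i #|T_ i|)%N.
Proof. by rewrite -card_fprod; apply/esym/bij_eq_card/dffun_of_fprod_bij. Qed.

(** * Generating polynomials of Krawtchouk values *)

Section Krawtchouk.
Variable R : comNzRingType.

(** For [w <= n], the coefficient of degree [k] is the value at [w] of the [q]-ary Krawtchouk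
    polynomial of degree [k] and length [n]. *)
Definition krawtchouk (n q w : nat) : {poly R} :=
  (1 + (q%:R - 1)%:P * 'X) ^+ (n - w) * (1 - 'X) ^+ w.

(** With constant terms 1, the coefficient of degree 1 acts as a logarithmic derivative at 0: it
    turns products into sums. *)
Let coef01M (p r : {poly R}) : p`_0 = 1 -> r`_0 = 1 ->
  (p * r)`_0 = 1 /\ (p * r)`_1 = p`_1 + r`_1.
Proof.
move=> p0 r0; rewrite !coefM !big_ord_recl !big_ord0 /= p0 r0.
by rewrite !mul1r mulr1 !addr0 addrC.
Qed.

Let coef01X (p : {poly R}) k : p`_0 = 1 ->
  (p ^+ k)`_0 = 1 /\ (p ^+ k)`_1 = k%:R * p`_1.
Proof.
move=> p0; elim: k => [|k [IH0 IH1]]; first by rewrite expr0 !coef1 mul0r.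
have [c0 c1] := coef01M p0 IH0.
by rewrite exprS c0 c1 IH1 -natr1 mulrDl mul1r addrC.
Qed.

Lemma krawtchouk01 n q w : (w <= n)%N ->
  (krawtchouk n q w)`_0 = 1 /\
  (krawtchouk n q w)`_1 = n%:R * (q%:R - 1) - q%:R * w%:R.
Proof.
move=> le_wn.
have a0 : (1 + (q%:R - 1)%:P * 'X : {poly R})`_0 = 1.
  by rewrite coefD coef1 coefCM coefX mulr0 addr0.
have b0 : (1 - 'X : {poly R})`_0 = 1 by rewrite coefB coef1 coefX subr0.
have [c0 c1] := coef01X (n - w) a0; have [d0 d1] := coef01X w b0.
have [e0 e1] := coef01M c0 d0; rewrite /krawtchouk e0 e1; split=> //.
rewrite c1 d1 coefD coefB coefCM !coef1 coefX /= mulr1 add0r sub0r natrB //.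
by rewrite mulrN1 mulrBl -addrA -opprD [w%:R * _]mulrBr mulr1 subrK [w%:R * _]mulrC.
Qed.

(** Each coordinate contributes one of the two linear factors of the Krawtchouk polynomial. The
    scalars [d j] are 1 for socle sums and the sizes of the radicals for radical sums. *)
Lemma prod_krawtchouk n q (d : 'I_n -> R) (z : pred 'I_n) :
  \prod_j ((d j)%:P + (d j * if z j then q%:R - 1 else -1)%:P * 'X) =
  (\prod_j d j)%:P * krawtchouk n q #|[set j | ~~ z j]|.
Proof.
have cz : #|[set j | z j]| = (n - #|[set j | ~~ z j]|)%N.
  have -> : [set j | ~~ z j] = ~: [set j | z j] by apply/setP=> j; rewrite !inE.
  by have := cardsC [set j | z j]; rewrite card_ord => /(canRL (addnK _)).
rewrite rmorph_prod /krawtchouk -cz -!prodr_const.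
rewrite [X in _ * (X * _)](big_mkcond (mem [set j | z j])) /=.
rewrite [X in _ * (_ * X)](big_mkcond (mem [set j | ~~ z j])) /= -!big_split /=.
apply: eq_bigr => j _; rewrite !inE; case: (z j) => /=.
  transitivity ((d j)%:P * (1 + (q%:R - 1)%:P * 'X)).
    by rewrite [RHS]mulrDr mulr1 polyCM mulrA.
  by congr (_ * _); exact: esym (mulr1 _).
transitivity ((d j)%:P * (1 - 'X)).
  by rewrite mulrN1 [RHS]mulrBr mulr1 polyCN mulNr.
by congr (_ * _); exact: esym (mul1r _).
Qed.

End Krawtchouk.

(** * Partitions into the fibers of a key *)

Section PreimPartition.
Variables (T K L : finType).

(** Values missed by [key] have empty fibers; removing [set0] gives the shape of [Hpart] and
    [Qpart]. *)
Lemma preim_partition_fibers (key : T -> K) :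
  preim_partition key [set: T] = [set [set a | key a == k] | k : K] :\ set0.
Proof.
apply/setP=> B; rewrite !inE; apply/imsetP/andP => [[a _ ->]|[B0 /imsetP[k _ BE]]].
  split; first by apply/set0Pn; exists a; rewrite !inE eqxx.
  by apply/imsetP; exists (key a) => //; apply/setP=> b; rewrite !inE eq_sym.
have /set0Pn[a] := B0; rewrite BE inE => /eqP ka.
by exists a => //; apply/setP=> b; rewrite !inE eq_sym ka.
Qed.

Lemma eq_preim_partition (key : T -> K) (key' : T -> L) :
  (forall a b, (key a == key b) = (key' a == key' b)) ->
  preim_partition key [set: T] = preim_partition key' [set: T].
Proof. by move=> E; apply: eq_imset => a; apply/setP=> b; rewrite !inE E. Qed.

Lemma card_preim_partition (key : T -> K) :
  #|preim_partition key [set: T]| = #|key @: [set: T]|.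
Proof.
have -> : preim_partition key [set: T] =
          [set [set a | key a == k] | k in key @: [set: T]].
  by rewrite -imset_comp; apply: eq_imset => a; apply/setP=> b; rewrite !inE eq_sym.
rewrite card_in_imset // => _ _ /imsetP[a _ ->] /imsetP[b _ ->] /setP/(_ a).
by rewrite !inE eqxx => /esym/eqP.
Qed.

(** Reduces the computation of a dual partition to showing that [key'] records the same information
    as the family of block sums. *)
Lemma dual_preim_partition (key : T -> K) (key' : T -> L) (c : T -> T -> algC) :
  (forall a a', key' a = key' a' <-> forall k,
     \sum_(b | key b == k) c a b = \sum_(b | key b == k) c a' b) ->
  equivalence_partition (fun a a' => [forall B in preim_partition key [set: T],
    \sum_(b in B) c a b == \sum_(b in B) c a' b]) [set: T] =
  preim_partition key' [set: T].
Proof.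
move=> E; apply: eq_imset => a; apply/setP=> a'; rewrite !inE /=.
apply/forall_inP/eqP => [h|/E h B].
  (* A value [k] that is not attained indexes no block, but both of its sums are empty. *)
  apply/E => k; have [k0|] := eqVneq [set b | key b == k] set0.
    by rewrite !big_pred0 // => b; have /setP/(_ b) := k0; rewrite !inE.
  move=> k0; have Bk : [set b | key b == k] \in preim_partition key [set: T].
    by rewrite preim_partition_fibers !inE k0 imset_f.
  have /eqP := h _ Bk.
  by rewrite !(eq_bigl _ _ (fun b => in_set (fun b => key b == k) b)).
rewrite preim_partition_fibers !inE => /andP[_ /imsetP[k _ ->]].
by rewrite !(eq_bigl _ _ (fun b => in_set (fun b => key b == k) b)) h.
Qed.

End PreimPartition.

(** * Sums of products under coordinatewise and counting conditions *)

Lemma sum_dffun_cond (R : comPzSemiRingType) (I : finType) (T_ : I -> finType)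
    (P : forall i, pred (T_ i)) (F : forall i, T_ i -> R) :
  \sum_(f : {dffun forall i, T_ i} | [forall i, P i (f i)]) \prod_i F i (f i) =
  \prod_i \sum_(x : T_ i | P i x) F i x.
Proof.
under [RHS]eq_bigr => i _ do rewrite big_mkcond.
rewrite bigA_distr_dffun big_mkcond /=; apply: eq_bigr => f _.
case: forallP => [Pf|/forallP]; first by apply: eq_bigr => i _; rewrite Pf.
by move/forallPn=> [i nPi]; rewrite (bigD1 i) //= (negPf nPi) mul0r.
Qed.

(** The indeterminate marks the coordinates that satisfy [p], so the degree of each term of the
    expanded product counts them. *)
Lemma sum_dffun_count (R : comNzRingType) (I : finType) (T_ : I -> finType)
    (p : forall i, pred (T_ i)) (g : forall i, T_ i -> R) k :
  \sum_(f : {dffun forall i, T_ i} | #|[set i | p i (f i)]| == k)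
     \prod_i g i (f i) =
  (\prod_i ((\sum_(x | ~~ p i x) g i x)%:P +
            (\sum_(x | p i x) g i x)%:P * 'X))`_k.
Proof.
have factor i : (\sum_(x | ~~ p i x) g i x)%:P + (\sum_(x | p i x) g i x)%:P * 'X =
    \sum_(x : T_ i) (g i x)%:P * 'X^(p i x).
  rewrite [RHS](bigID (p i)) /= [RHS]addrC !rmorph_sum big_distrl /=.
  congr (_ + _); last by apply: eq_bigr => x ->; rewrite expr1.
  by apply: eq_bigr => x /negPf->; rewrite expr0 mulr1.
under eq_bigr => i _ do rewrite factor.
rewrite bigA_distr_dffun coef_sum big_mkcond; apply: eq_bigr => f _ /=.
rewrite big_split /= -rmorph_prod prodrXr coefCM coefXn.
have -> : (\sum_i p i (f i) = #|[set i | p i (f i)]|)%N.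
  by rewrite -sum1dep_card [RHS]big_mkcond; apply: eq_bigr => i _; case: (p i _).
by rewrite eq_sym; case: eqP; rewrite ?mulr1 ?mulr0.
Qed.

(** * The product ring, its weight vectors and its characters *)

Section Product.
Variables (t : nat) (n : 'I_t -> nat).
Variable Rf : forall i : 'I_t, 'I_(n i) -> finNzRingType.
Arguments Rf : clear implicits.
Local Notation Rp := (Rprod t n Rf).
Local Notation M := (Mset t n).
Local Notation zero := (zeroR t n Rf).
Implicit Types (a b : Rp) (m : M).

Lemma RprodP a b : (forall i j, a i j = b i j) -> a = b.
Proof. by move=> h; apply/ffunP=> i; apply/ffunP=> j. Qed.

Lemma addRE a b i j : addR t n Rf a b i j = a i j + b i j.
Proof. by rewrite /addR !ffunE. Qed.

Lemma mulRE a b i j : mulR t n Rf a b i j = a i j * b i j.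
Proof. by rewrite /mulR !ffunE. Qed.

Lemma zeroRE i j : zero i j = 0.
Proof. by rewrite /zeroR !ffunE. Qed.

Lemma RprodPn a b : a != b -> exists i j, a i j != b i j.
Proof.
move=> ab; have /existsP[i /existsP[j h]] : [exists i, exists j, a i j != b i j].
  apply: contraNT ab => /existsPn h; apply/eqP/RprodP=> i j.
  by have /existsPn/(_ j) := h i; rewrite negbK => /eqP.
by exists i, j.
Qed.

(** The default value of [inord] never occurs, since a count over ['I_(n i)] is at most [n i]. *)
Definition count_vec (p : forall i j, pred (Rf i j)) (a : Rp) : M :=
  [ffun i => inord #|[set j | p i j (a i j)]|].

Lemma count_vecE p a i : count_vec p a i = #|[set j | p i j (a i j)]| :> nat.
Proof. by rewrite ffunE inordK // ltnS -[X in (_ <= X)%N]card_ord max_card. Qed.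

Lemma eq_count_vec p a m :
  (count_vec p a == m) = [forall i, #|[set j | p i j (a i j)]| == m i].
Proof.
apply/eqP/forallP => [<- i|h]; first by rewrite count_vecE.
by apply/ffunP=> i; apply: val_inj; rewrite /= count_vecE; apply/eqP.
Qed.

Lemma sum_count_vec p (g : forall i j, Rf i j -> algC) m :
  \sum_(b | count_vec p b == m) \prod_i \prod_j g i j (b i j) =
  \prod_i (\prod_j ((\sum_(x | ~~ p i j x) g i j x)%:P +
                    (\sum_(x | p i j x) g i j x)%:P * 'X))`_(m i).
Proof.
rewrite (eq_bigl _ _ (fun b => eq_count_vec p b m)).
rewrite (sum_dffun_cond (T_ := fun i => Ri t n Rf i)
  (fun i (x : Ri t n Rf i) => #|[set j | p i j (x j)]| == m i)
  (fun i x => \prod_j g i j (x j))).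
by apply: eq_bigr => i _; rewrite -sum_dffun_count.
Qed.

Lemma sum_Rprod (g : forall i j, Rf i j -> algC) :
  \sum_(b : Rp) \prod_i \prod_j g i j (b i j) = \prod_i \prod_j \sum_x g i j x.
Proof.
rewrite -(bigA_distr_dffun (T_ := fun i => Ri t n Rf i)
  (fun i x => \prod_j g i j (x j))).
by apply: eq_bigr => i _; rewrite bigA_distr_dffun.
Qed.

(** The embedding of one component; composed with [chi], it gives the component characters. *)
Definition single i j (x : Rf i j) : Rp :=
  [ffun i' => dfwith (fun i' => [ffun => 0] : Ri t n Rf i')
    ([ffun j' => dfwith (fun j' => 0 : Rf i j') x j'] : Ri t n Rf i) i'].

Lemma single_in i j (x : Rf i j) : single x i j = x.
Proof. by rewrite ffunE dfwith_in ffunE dfwith_in. Qed.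

Lemma single_out i j (x : Rf i j) j' : j != j' -> single x i j' = 0.
Proof. by move=> jj'; rewrite ffunE dfwith_in ffunE dfwith_out. Qed.

Lemma single_out1 i j (x : Rf i j) i' j' : i != i' -> single x i' j' = 0.
Proof. by move=> ii'; rewrite ffunE dfwith_out // ffunE. Qed.

Lemma singleD i j (x y : Rf i j) :
  single (x + y) = addR t n Rf (single x) (single y).
Proof.
apply: RprodP => i' j'; rewrite addRE.
have [e|ii'] := eqVneq i i'; last by rewrite !single_out1 ?addr0.
case: _ / e j' => j'; have [e|jj'] := eqVneq j j'.
  by rewrite -e !single_in.
by rewrite !single_out ?addr0.
Qed.

Lemma mulR_single a i j (x : Rf i j) :
  mulR t n Rf a (single x) = single (a i j * x).
Proof.
apply: RprodP => i' j'; rewrite mulRE.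
have [e|ii'] := eqVneq i i'; last by rewrite !single_out1 ?mulr0.
case: _ / e j' => j'; have [e|jj'] := eqVneq j j'.
  by rewrite -e !single_in.
by rewrite !single_out ?mulr0.
Qed.

Lemma sum_single a :
  a = \big[addR t n Rf/zero]_i \big[addR t n Rf/zero]_j single (a i j).
Proof.
apply: RprodP => i j.
have comp := big_morph (fun b : Rp => b i j) (fun b c => @addRE b c i j) (@zeroRE i j).
rewrite comp (bigD1 i) //= comp (bigD1 j) //= single_in !big1 ?addr0 //.
- by move=> i' ii'; rewrite comp big1 // => j' _; rewrite single_out1.
- by move=> j' jj'; rewrite single_out.
Qed.

Section Character.
Variable chi : Rp -> algC.
Hypothesis chi_gen : generating_char Rp (addR t n Rf) (mulR t n Rf) chi.

Definition chi_comp i j (x : Rf i j) : algC := chi (single x).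

Lemma chi_zero : chi zero = 1.
Proof.
have [[nz hD] _ _] := chi_gen; apply: (mulIf (nz zero)).
rewrite -hD mul1r; congr chi.
by apply: RprodP => i j; rewrite addRE zeroRE addr0.
Qed.

Lemma chi_prod a : chi a = \prod_i \prod_j chi_comp (a i j).
Proof.
have [[_ hD] _ _] := chi_gen.
have chi_big := big_morph chi hD chi_zero.
rewrite {1}[a]sum_single chi_big; apply: eq_bigr => i _; exact: chi_big.
Qed.

Lemma chi_compD i j (x y : Rf i j) :
  chi_comp (x + y) = chi_comp x * chi_comp y.
Proof. by have [[_ hD] _ _] := chi_gen; rewrite /chi_comp singleD hD. Qed.

Lemma chi_comp_neq0 i j (x : Rf i j) : chi_comp x != 0.
Proof. by have [[nz _] _ _] := chi_gen; apply: nz. Qed.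

(** Since [a * single r] is [single (a i j * r)], the elements [single r] and [zero] induce the same
    character, so the generating property identifies them. *)
Lemma chi_comp_nondeg i j (r : Rf i j) :
  (forall x, chi_comp (x * r) = 1) -> r = 0.
Proof.
move=> hr; have [_ inj _] := chi_gen.
rewrite -(single_in r) (inj (single r) zero) ?zeroRE // => a.
rewrite mulR_single (_ : mulR _ _ _ a zero = zero) ?chi_zero; first exact: hr.
by apply: RprodP => i' j'; rewrite mulRE zeroRE mulr0.
Qed.

End Character.
End Product.

(** * The two partitions as fibers of keys *)

Section Keys.
Variables (t : nat) (n : 'I_t -> nat).
Variable Rf : forall i : 'I_t, 'I_(n i) -> finNzRingType.
Arguments Rf : clear implicits.
Local Notation Rp := (Rprod t n Rf).
Local Notation M := (Mset t n).
Local Notation zero := (zeroR t n Rf).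
Implicit Types (a b : Rp) (m : M).

Definition wt_vec : Rp -> M := count_vec (fun i j (x : Rf i j) => x != 0).
Definition wtbar_vec : Rp -> M :=
  count_vec (fun i j (x : Rf i j) => x \notin rad (Rf i j)).

Definition zero_vec : M := [ffun => ord0].

(* [None] encodes the index [diamond] of the blocks of [Hpart]. *)
Definition soc_key a : option M :=
  if a \in socR t n Rf then Some (wt_vec a) else None.

(* In [Qpart], the block of index [diamond] has key [(0, false)]. *)
Definition rad_key a : M * bool := (wtbar_vec a, a == zero).

Lemma socRP a : reflect (forall i j, a i j \in soc (Rf i j)) (a \in socR t n Rf).
Proof.
rewrite inE; apply: (iffP forallP) => [h i j|h i]; first exact: (forallP (h i)).
by apply/forallP=> j.
Qed.

Lemma radRP a : reflect (forall i j, a i j \in rad (Rf i j)) (a \in radR t n Rf).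
Proof.
rewrite inE; apply: (iffP forallP) => [h i j|h i]; first exact: (forallP (h i)).
by apply/forallP=> j.
Qed.

Lemma count_vec_eq0 (p : forall i j, pred (Rf i j)) a :
  reflect (forall i j, ~~ p i j (a i j)) (count_vec p a == zero_vec).
Proof.
rewrite eq_count_vec; apply: (iffP forallP) => [h i j|h i].
  have := h i; rewrite ffunE cards_eq0 => /eqP/setP/(_ j).
  by rewrite inE inE => ->.
by rewrite ffunE cards_eq0; apply/eqP/setP=> j; rewrite inE (negPf (h i j)) inE.
Qed.

Lemma wtbar_vec_eq0 a : (wtbar_vec a == zero_vec) = (a \in radR t n Rf).
Proof.
apply/count_vec_eq0/radRP => h i j; first by have := h i j; rewrite negbK.
by rewrite negbK.
Qed.

Lemma wt_vec_eq0 a : (wt_vec a == zero_vec) = (a == zero).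
Proof.
apply/count_vec_eq0/eqP => [h|-> i j]; last by rewrite zeroRE eqxx.
by apply: RprodP => i j; have := h i j; rewrite negbK zeroRE => /eqP.
Qed.

Lemma m_nonzeroE m : m_nonzero t n m = (m != zero_vec).
Proof.
apply/negb_inj; rewrite negbK; apply/existsPn/eqP => [h|-> i].
  by apply/ffunP=> i; apply: val_inj; have := h i; rewrite negbK ffunE => /eqP.
by rewrite ffunE negbK.
Qed.

Lemma PblockE m : Pblock t n Rf m = [set a | soc_key a == Some m].
Proof.
apply/setP=> a; rewrite [LHS]inE [RHS]inE /soc_key.
case: (a \in socR _ _ _) => //=.
exact: esym (eq_count_vec _ _ _).
Qed.

Lemma PdiamondE : Pdiamond t n Rf = [set a | soc_key a == None].
Proof.
by apply/setP=> a; rewrite in_setC [RHS]inE /soc_key; case: (a \in socR _ _ _).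
Qed.

Lemma HpartE : Hpart t n Rf = preim_partition soc_key [set: Rp].
Proof.
rewrite preim_partition_fibers; congr (_ :\ _); apply/setP=> B.
rewrite in_setU1; apply/orP/imsetP => [[/eqP->|/imsetP[m _ ->]]|[[m|] _ ->]].
- by exists None; rewrite ?PdiamondE.
- by exists (Some m); rewrite ?PblockE.
- by right; apply/imsetP; exists m; rewrite ?PblockE.
- by left; rewrite PdiamondE.
Qed.

Hypothesis Rf_local : forall i j, local_ring (Rf i j).

Lemma zero_radR : zero \in radR t n Rf.
Proof. by apply/radRP=> i j; rewrite zeroRE rad0. Qed.

Lemma QblockE m : m != zero_vec ->
  Qblock t n Rf m = [set a | rad_key a == (m, false)].
Proof.
move=> m0; apply/setP=> a; rewrite [LHS]inE [RHS]inE in_setC -wtbar_vec_eq0.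
have -> : [forall i, wtbar t n Rf i (a i) == m i] = (wtbar_vec a == m).
  exact: esym (eq_count_vec _ _ _).
rewrite xpair_eqE andbC; case: (eqVneq (wtbar_vec a) m) => //= aE.
rewrite aE m0; case: (eqVneq a zero) => // a0; move: m0.
by rewrite -aE a0 wtbar_vec_eq0 zero_radR.
Qed.

Lemma QdiamondE : Qdiamond t n Rf = [set a | rad_key a == (zero_vec, false)].
Proof.
apply/setP=> a; rewrite in_setD1 [RHS]inE xpair_eqE -wtbar_vec_eq0 andbC.
by case: (a == zero).
Qed.

Lemma rad_key_zero m :
  [set a | rad_key a == (m, true)] = if m == zero_vec then [set zero] else set0.
Proof.
apply/setP=> a; rewrite inE xpair_eqE eqb_id.
case: (eqVneq a zero) => [->|a0]; rewrite ?andbF ?andbT; last first.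
  by case: ifP => _; rewrite !inE // (negPf a0).
have := zero_radR; rewrite -wtbar_vec_eq0 => /eqP->.
by rewrite eq_sym; case: ifP; rewrite !inE ?eqxx.
Qed.

(** The singleton of zero is the fiber of [(zero_vec, true)]; the keys [(m, true)] with another [m]
    have empty fibers. *)
Lemma QpartE : Qpart t n Rf = preim_partition rad_key [set: Rp].
Proof.
rewrite preim_partition_fibers; apply/setP=> B; rewrite !in_setD1.
apply: andb_id2l => B0; rewrite !in_setU1.
apply/or3P/imsetP => [[/eqP->|/eqP->|/imsetP[m]]|[[m []] _ BE]].
- by exists (zero_vec, false); rewrite ?QdiamondE.
- by exists (zero_vec, true); rewrite ?rad_key_zero ?eqxx.
- by rewrite inE m_nonzeroE => m0 ->; exists (m, false); rewrite ?QblockE.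
- move: BE B0; rewrite rad_key_zero; case: ifP => _ -> B0.
    by constructor 2.
  by rewrite eqxx in B0.
- have [mE|m0] := eqVneq m zero_vec.
    by constructor 1; rewrite BE mE QdiamondE.
  by constructor 3; apply/imsetP; exists m; rewrite ?QblockE // inE m_nonzeroE.
Qed.

End Keys.

(** * Block sums and what they determine *)

Section Duality.
Variables (t : nat) (n : 'I_t -> nat).
Variable Rf : forall i : 'I_t, 'I_(n i) -> finNzRingType.
Arguments Rf : clear implicits.
Variable q : 'I_t -> nat.
Local Notation Rp := (Rprod t n Rf).
Local Notation M := (Mset t n).
Local Notation zero := (zeroR t n Rf).
Local Notation kraw := (krawtchouk algC).
Implicit Types (a b : Rp) (m : M).

Hypothesis n_gt0 : forall i, (0 < n i)%N.
Hypothesis Rf_local : forall i j, local_ring (Rf i j).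
Hypothesis card_quot : forall i j, card_quot_rad (Rf i j) = q i.
Hypothesis card_soc : forall i j, #|soc (Rf i j)| = q i.

Lemma q_gt1 i : (1 < q i)%N.
Proof. by rewrite -(card_quot (Ordinal (n_gt0 i))) card_quot_rad_gt1. Qed.

(* The coefficient of degree 1 at the coordinate [i] is affine in [w i]. *)
Lemma krawtchouk_separates (d : 'I_t -> algC) (w w' : M) :
  (forall i, d i != 0) ->
  (forall m, \prod_i (d i * (kraw (n i) (q i) (w i))`_(m i)) =
             \prod_i (d i * (kraw (n i) (q i) (w' i))`_(m i))) ->
  w = w'.
Proof.
move=> d0 eq_w; apply/ffunP=> i0; apply: val_inj => /=.
(* The unit vector at [i0], in range because each [n i] is positive: it selects the coefficient of
   degree 1 at [i0] and the constant term 1 elsewhere. *)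
pose e : M := [ffun i => inord (i == i0)].
have eE i : e i = (i == i0) :> nat.
  by rewrite ffunE inordK // ltnS; case: (i == i0).
have prodE (v : M) : \prod_i (d i * (kraw (n i) (q i) (v i))`_(e i)) =
    (\prod_i d i) * ((n i0)%:R * ((q i0)%:R - 1) - (q i0)%:R * (v i0)%:R).
  have le_v i : (v i <= n i)%N by rewrite -ltnS.
  rewrite big_split /= (bigD1 i0 (P := xpredT) (F := fun i => (kraw _ _ _)`_(e i))) //=.
  rewrite eE eqxx /= (krawtchouk01 _ _ (le_v i0)).2.
  rewrite [X in _ * (_ * X)]big1 ?mulr1 // => i /negPf ii0.
  by rewrite eE ii0 /= (krawtchouk01 _ _ (le_v i)).1.
have D0 : \prod_i d i != 0 by apply/prodf_neq0.
have q0 : (q i0)%:R != 0 :> algC.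
  by rewrite pnatr_eq0 -lt0n (leq_trans _ (q_gt1 i0)).
have := eq_w e; rewrite !prodE => /(mulfI D0)/addrI/oppr_inj/(mulfI q0)/eqP.
by rewrite eqr_nat => /eqP.
Qed.

(** * Sums over the blocks of [Hpart] *)

Section SocleSums.
(** An abstract pairing, instantiated by [psi (x * y)] for the right dual and by [psi (y * x)] for
    the left dual. *)
Variable beta : forall i j, Rf i j -> Rf i j -> algC.
Arguments beta : clear implicits.
Hypothesis beta0 : forall i j x, beta i j x 0 = 1.
Hypothesis sum_beta_soc : forall i j x,
  \sum_(y in soc (Rf i j)) beta i j x y =
  if x \in rad (Rf i j) then (q i)%:R else 0.
Hypothesis sum_beta : forall i j x,
  \sum_y beta i j x y = if x == 0 then #|Rf i j|%:R else 0.

Let c a b := \prod_i \prod_j beta i j (a i j) (b i j).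

Lemma sum_soc_key_some a m :
  \sum_(b | soc_key b == Some m) c a b =
  \prod_i (kraw (n i) (q i) (wtbar_vec a i))`_(m i).
Proof.
(* Extension by 0 outside the socle leaves only the weight condition on the sum, which then factors
   over the components. *)
pose g i j (y : Rf i j) :=
  if y \in soc (Rf i j) then beta i j (a i j) y else 0.
transitivity (\sum_(b | wt_vec b == m) \prod_i \prod_j g i j (b i j)).
  rewrite big_mkcond [RHS]big_mkcond; apply: eq_bigr => b _ /=.
  rewrite /soc_key; case: socRP => [sb|nsb].
    rewrite (inj_eq Some_inj); case: eqP => // _.
    by apply: eq_bigr => i _; apply: eq_bigr => j _; rewrite /g sb.
  have [i [j nsbij]] : exists i j, b i j \notin soc (Rf i j).
    have /existsP[i /existsP[j h]] : [exists i, exists j, b i j \notin soc (Rf i j)].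
      apply: contra_notT nsb => /existsPn h i j.
      by have /existsPn/(_ j) := h i; rewrite negbK.
    by exists i, j.
  case: ifP => // _; rewrite (bigD1 i) //= (bigD1 j) //=.
  by rewrite {1}/g (negPf nsbij) !mul0r.
rewrite sum_count_vec; apply: eq_bigr => i _; congr (nth _ (polyseq _) _).
rewrite count_vecE.
transitivity ((\prod_(j < n i) 1)%:P *
  kraw (n i) (q i) #|[set j | ~~ (a i j \in rad (Rf i j))]|); last first.
  by rewrite big1_eq mul1r.
rewrite -(prod_krawtchouk (q i) (fun => 1) (fun j => a i j \in rad (Rf i j))).
apply: eq_bigr => j _.
(* The constant term comes from [y = 0]; the coefficient of degree 1 is therefore the socle sum
   minus 1. *)
have g0 : \sum_(y | ~~ (y != 0)) g i j y = 1.
  rewrite (big_pred1 0) => [|y]; last by rewrite negbK.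
  by rewrite /g soc0 // beta0.
rewrite g0 mul1r; congr (_ + _%:P * _).
have -> : \sum_(y | y != 0) g i j y =
    \sum_(y in soc (Rf i j)) beta i j (a i j) y - 1.
  rewrite [in RHS]big_mkcond [in RHS](bigID (fun y => y != 0)) /=.
  by rewrite -/(g i j) g0 addrK.
by rewrite sum_beta_soc; case: ifP => // _; rewrite sub0r.
Qed.

Let N : algC := \prod_i \prod_j #|Rf i j|%:R.

Lemma N_neq0 : N != 0.
Proof.
apply/prodf_neq0 => i _; apply/prodf_neq0 => j _.
by rewrite pnatr_eq0 -lt0n; apply/card_gt0P; exists 0.
Qed.

Lemma sum_soc_total a : \sum_b c a b = if a == zero then N else 0.
Proof.
rewrite (sum_Rprod (fun i j => beta i j (a i j))); case: eqVneq => [->|a0].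
  by apply: eq_bigr => i _; apply: eq_bigr => j _; rewrite zeroRE sum_beta eqxx.
have [i [j]] := RprodPn a0; rewrite zeroRE => aij.
by rewrite (bigD1 i) //= (bigD1 j) //= sum_beta (negPf aij) !mul0r.
Qed.

(** The sum over the complement of the socle is the total sum minus the sums over the blocks
    [Pblock m]. Those determine the weights modulo the radical, and the total tells whether [a] is
    zero. *)
Lemma soc_key_sums a a' :
  rad_key a = rad_key a' <-> forall k,
    \sum_(b | soc_key b == k) c a b = \sum_(b | soc_key b == k) c a' b.
Proof.
have total v : \sum_b c v b = \sum_(k : option M) \sum_(b | soc_key b == k) c v b.
  exact: partition_big.
split=> [[w_eq z_eq]|h].
  have hs m : \sum_(b | soc_key b == Some m) c a b =
              \sum_(b | soc_key b == Some m) c a' b.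
    by rewrite !sum_soc_key_some w_eq.
  move=> [m|]; first exact: hs.
  have : \sum_b c a b = \sum_b c a' b by rewrite !sum_soc_total z_eq.
  rewrite !total (bigD1 None) //= [in RHS](bigD1 None) //=.
  rewrite (eq_bigr (fun k => \sum_(b | soc_key b == k) c a' b)) => [/addIr //|].
  by move=> [m|] // _; exact: hs.
congr pair.
  apply: (@krawtchouk_separates (fun _ => 1)) => [i|m]; first exact: oner_neq0.
  have := h (Some m); rewrite !sum_soc_key_some => hm.
  by under eq_bigr do rewrite mul1r; under [RHS]eq_bigr do rewrite mul1r.
have : \sum_b c a b = \sum_b c a' b by rewrite !total; apply: eq_bigr => k _.
rewrite !sum_soc_total; case: eqP => _; case: eqP => _ // /eqP.
  by rewrite (negPf N_neq0).
by rewrite eq_sym (negPf N_neq0).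
Qed.

End SocleSums.

(** * Sums over the blocks of [Qpart] *)

Section RadicalSums.
Variable psi : forall i j, Rf i j -> algC.
Arguments psi : clear implicits.
Hypothesis sum_rad : forall i j x,
  \sum_(y in rad (Rf i j)) psi i j (y * x) =
  if x \in soc (Rf i j) then #|rad (Rf i j)|%:R else 0.
Hypothesis sum_radC : forall i j x,
  \sum_(y | y \notin rad (Rf i j)) psi i j (y * x) =
  if x \in soc (Rf i j)
  then #|rad (Rf i j)|%:R * (if x == 0 then (q i)%:R - 1 else -1) else 0.

Let c a b := \prod_i \prod_j psi i j (b i j * a i j).
Let d i : algC := \prod_j #|rad (Rf i j)|%:R.

Let d_neq0 i : d i != 0.
Proof.
apply/prodf_neq0 => j _.
by rewrite pnatr_eq0 -lt0n; apply/card_gt0P; exists 0; rewrite rad0.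
Qed.

Lemma sum_wtbar_soc a m : a \in socR t n Rf ->
  \sum_(b | wtbar_vec b == m) c a b =
  \prod_i (d i * (kraw (n i) (q i) (wt_vec a i))`_(m i)).
Proof.
move/socRP=> sa.
rewrite (sum_count_vec _ (fun i j y => psi i j (y * a i j))); apply: eq_bigr => i _.
rewrite count_vecE -coefCM; congr (nth _ (polyseq _) _).
rewrite -(prod_krawtchouk (q i) (fun j => #|rad (Rf i j)|%:R) (fun j => a i j == 0)).
apply: eq_bigr => j _.
rewrite sum_radC sa; congr (_%:P + _).
by under eq_bigl do rewrite negbK; rewrite sum_rad sa.
Qed.

(** At a coordinate of [a] outside the socle, the sums over the radical and over its complement both
    vanish, so its linear factor is 0. *)
Lemma sum_wtbar_nsoc a m : a \notin socR t n Rf ->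
  \sum_(b | wtbar_vec b == m) c a b = 0.
Proof.
move=> nsa.
have /existsP[i /existsP[j h]] : [exists i, exists j, a i j \notin soc (Rf i j)].
  apply: contraNT nsa => /existsPn h; apply/socRP=> i j.
  by have /existsPn/(_ j) := h i; rewrite negbK.
rewrite (sum_count_vec _ (fun i j y => psi i j (y * a i j))).
rewrite (bigD1 i) //= (bigD1 j) //= sum_radC (negPf h).
under eq_bigl do rewrite negbK.
by rewrite sum_rad (negPf h) polyC0 mul0r addr0 mul0r coef0 mul0r.
Qed.

Let sum_wtbar_zero a : a \in socR t n Rf ->
  \sum_(b | wtbar_vec b == zero_vec n) c a b = \prod_i d i.
Proof.
move=> sa; rewrite sum_wtbar_soc //; apply: eq_bigr => i _.
have -> : zero_vec n i = 0%N :> nat by rewrite ffunE.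
by rewrite (krawtchouk01 _ _ _).1 ?mulr1 // -ltnS.
Qed.

(** A weight class differs from a block at most by the element zero, whose term does not depend on
    [a]; so the sums over weight classes carry the same information. *)
Lemma rad_key_sums a a' :
  soc_key a = soc_key a' <-> forall k,
    \sum_(b | rad_key b == k) c a b = \sum_(b | rad_key b == k) c a' b.
Proof.
have split_key v m : \sum_(b | wtbar_vec b == m) c v b =
    \sum_(b | rad_key b == (m, true)) c v b +
    \sum_(b | rad_key b == (m, false)) c v b.
  rewrite (bigID (fun b => b == zero)) /=; congr (_ + _); apply: eq_bigl => b.
    by rewrite xpair_eqE eqb_id.
  by rewrite xpair_eqE eqbF_neg.
have cst m : \sum_(b | rad_key b == (m, true)) c a b =
             \sum_(b | rad_key b == (m, true)) c a' b.
  apply: eq_bigr => b; rewrite xpair_eqE eqb_id => /andP[_ /eqP->].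
  by apply: eq_bigr => i _; apply: eq_bigr => j _; rewrite zeroRE !mul0r.
have wtbarP : (forall m, \sum_(b | wtbar_vec b == m) c a b =
                         \sum_(b | wtbar_vec b == m) c a' b) <->
  forall k, \sum_(b | rad_key b == k) c a b = \sum_(b | rad_key b == k) c a' b.
  split=> [h [m []]|h m]; [exact: cst | | by rewrite !split_key !h].
  by have := h m; rewrite !split_key cst => /addrI.
have D0 : \prod_i d i != 0 by apply/prodf_neq0.
apply: iff_trans wtbarP; rewrite /soc_key; split=> [|h].
  case: ifPn => sa; case: ifPn => sa' //; last by move=> _ m; rewrite !sum_wtbar_nsoc.
  by move=> [h] m; rewrite !sum_wtbar_soc // h.
case: ifPn => sa; case: ifPn => sa' //.
- congr Some; apply: (krawtchouk_separates d_neq0) => m.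
  by rewrite -!sum_wtbar_soc.
(* The class of weight zero is the radical: its sum is the nonzero product of the [d i] on the socle
   and 0 off it. *)
- have /eqP := h (zero_vec n).
  by rewrite sum_wtbar_zero // sum_wtbar_nsoc // (negPf D0).
- have /eqP := h (zero_vec n).
  by rewrite eq_sym sum_wtbar_zero // sum_wtbar_nsoc // (negPf D0).
Qed.

End RadicalSums.
End Duality.

(** * The dual partitions, the number of blocks and the case of a semisimple ring *)

Section MainResults.
Variables (t : nat) (n : 'I_t -> nat).
Variable Rf : forall i : 'I_t, 'I_(n i) -> finNzRingType.
Arguments Rf : clear implicits.
Variable q : 'I_t -> nat.
Local Notation Rp := (Rprod t n Rf).
Local Notation M := (Mset t n).
Local Notation zero := (zeroR t n Rf).
Local Notation H := (Hpart t n Rf).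
Implicit Types (a b : Rp) (m : M).

Hypothesis n_gt0 : forall i, (0 < n i)%N.
Hypothesis Rf_local : forall i j, local_ring (Rf i j).
Hypothesis card_quot : forall i j, card_quot_rad (Rf i j) = q i.
Hypothesis card_soc : forall i j, #|soc (Rf i j)| = q i.

Section Duals.
Variable chi : Rp -> algC.
Hypothesis chi_gen : generating_char Rp (addR t n Rf) (mulR t n Rf) chi.
Local Notation psi := (chi_comp chi).

Let chi_mulR a b : chi (mulR t n Rf a b) = \prod_i \prod_j psi (a i j * b i j).
Proof.
rewrite (chi_prod chi_gen); apply: eq_bigr => i _; apply: eq_bigr => j _.
by rewrite mulRE.
Qed.

Let psiD i j := @chi_compD t n Rf chi chi_gen i j.
Let psi_neq0 i j := @chi_comp_neq0 t n Rf chi chi_gen i j.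
Let psi_nondeg i j := @chi_comp_nondeg t n Rf chi chi_gen i j.
Let psi_zero i j : psi (0 : Rf i j) = 1.
Proof. exact: (psi0 (@psiD i j) (@psi_neq0 i j)). Qed.

Lemma rdual_HpartE : rdual t n Rf chi H = preim_partition (@rad_key t n Rf) [set: Rp].
Proof.
rewrite /rdual HpartE; apply: dual_preim_partition => a a'.
have := @soc_key_sums t n Rf q n_gt0 Rf_local card_quot
  (fun i j x y => psi (x * y)) _ _ _ a a'.
case=> [i j x|i j x|i j x|h1 h2].
- by rewrite mulr0 psi_zero.
- exact: (sum_char_socMl (@psiD i j) (@psi_neq0 i j) (@psi_nondeg i j)
    (Rf_local j) (card_quot j) (card_soc j)).
- exact: (sum_charMl (@psiD i j) (@psi_neq0 i j) (@psi_nondeg i j)).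
split=> [/h1 h k|h].
  by rewrite !(eq_bigr _ (fun b _ => chi_mulR _ b)) h.
apply: h2 => k; have := h k.
by rewrite !(eq_bigr _ (fun b _ => chi_mulR _ b)).
Qed.

Lemma ldual_HpartE : ldual t n Rf chi H = preim_partition (@rad_key t n Rf) [set: Rp].
Proof.
rewrite /ldual HpartE; apply: dual_preim_partition => a a'.
have := @soc_key_sums t n Rf q n_gt0 Rf_local card_quot
  (fun i j x y => psi (y * x)) _ _ _ a a'.
case=> [i j x|i j x|i j x|h1 h2].
- by rewrite mul0r psi_zero.
- exact: (sum_char_socMr (@psiD i j) (@psi_neq0 i j) (@psi_nondeg i j)
    (Rf_local j) (card_quot j) (card_soc j)).
- exact: (sum_charMr (@psiD i j) (@psi_neq0 i j) (@psi_nondeg i j)).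
split=> [/h1 h k|h].
  by rewrite !(eq_bigr _ (fun b _ => chi_mulR b _)) h.
apply: h2 => k; have := h k.
by rewrite !(eq_bigr _ (fun b _ => chi_mulR b _)).
Qed.

Lemma ldual_QpartE : ldual t n Rf chi (Qpart t n Rf) = H.
Proof.
rewrite HpartE (QpartE Rf_local); apply: dual_preim_partition => a a'.
have := @rad_key_sums t n Rf q n_gt0 Rf_local card_quot
  (fun i j => @chi_comp t n Rf chi i j) _ _ a a'.
case=> [i j x|i j x|h1 h2].
- exact: (sum_char_radMr (@psiD i j) (@psi_neq0 i j) (@psi_nondeg i j)
    (Rf_local j)).
- exact: (sum_char_radCMr (@psiD i j) (@psi_neq0 i j) (@psi_nondeg i j)
    (Rf_local j) (card_quot j)).
split=> [/h1 h k|h].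
  by rewrite !(eq_bigr _ (fun b _ => chi_mulR b _)) h.
apply: h2 => k; have := h k.
by rewrite !(eq_bigr _ (fun b _ => chi_mulR b _)).
Qed.

End Duals.

(** Nonzero socle elements are placed in the first [m i] components of each factor, and 0 in the
    others. *)
Lemma soc_key_onto m : exists a : Rp, soc_key a = Some m.
Proof.
have card_socE i j : #|soc (Rf i j)| = card_quot_rad (Rf i j).
  by rewrite card_soc card_quot.
have s_ex i j : exists x, (x \in soc (Rf i j)) && (x != 0).
  by have [x sx x0] := soc_neq0 (Rf_local j) (card_socE i j); exists x; apply/andP.
pose a : Rp := [ffun i => [ffun j : 'I_(n i) =>
  if (j < m i)%N then xchoose (s_ex i j) else 0] : Ri t n Rf i].
have aE i j : a i j = if (j < m i)%N then xchoose (s_ex i j) else 0.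
  by rewrite !ffunE.
have sP i j := andP (xchooseP (s_ex i j)).
exists a; rewrite /soc_key (_ : a \in socR t n Rf); last first.
  by apply/socRP=> i j; rewrite aE; case: ifP => _; [case: (sP i j) | exact: soc0].
congr Some; apply/eqP; rewrite eq_count_vec; apply/forallP=> i.
have -> : [set j | a i j != 0] = [set j : 'I_(n i) | (j < m i)%N].
  apply/setP=> j; rewrite !inE aE; case: ifP => _; last by rewrite eqxx.
  by case: (sP i j) => _ ->.
have le_m : (m i <= n i)%N by rewrite -ltnS.
by rewrite -sum1dep_card (big_ord_narrow le_m) sum_nat_const card_ord muln1.
Qed.

Lemma card_Mset : #|M| = (\prod_(i < t) (n i).+1)%N.
Proof. by rewrite card_dffun; apply: eq_bigr => i _; rewrite card_ord. Qed.

(** Blocks correspond to attained keys: every [Some m] is attained, and [None] exactly when the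
    socle is proper. *)
Lemma card_Hpart :
  #|H| = ((\prod_(i < t) (n i).+1) + (socR t n Rf != [set: Rp]))%N.
Proof.
rewrite HpartE card_preim_partition -card_Mset.
have [socT|/eqP nsocT] /= := eqVneq (socR t n Rf) [set: Rp].
  rewrite addn0 -(card_imset (mem M) Some_inj).
  apply: eq_card => k; apply/imsetP/imsetP => [[a _ ->]|[m _ ->]].
    by rewrite /soc_key socT inE; exists (wt_vec a).
  by have [a ak] := soc_key_onto m; exists a.
rewrite addn1 -card_option -cardsT; apply: eq_card => k; rewrite [RHS]inE.
apply/imsetP; case: k => [m|]; first by have [a ak] := soc_key_onto m; exists a.
have /existsP[a nsa] : [exists a, a \notin socR t n Rf].
  apply: contra_notT nsocT => /existsPn h.
  by apply/setP=> a; rewrite in_setT -[LHS]negbK h.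
by exists a; rewrite // /soc_key (negPf nsa).
Qed.

Section Semisimple.
Hypothesis socT : socR t n Rf = [set: Rp].

(** Here 1 lies in the socle, so the radical annihilates it. *)
Lemma semisimple_rad i j (x : Rf i j) : (x \in rad (Rf i j)) = (x == 0).
Proof.
apply/idP/eqP => [rx|->]; last exact: rad0.
have : single (1 : Rf i j) \in socR t n Rf by rewrite socT inE.
move/socRP/(_ i j); rewrite single_in => s1.
by rewrite -[x]mulr1 rad_soc.
Qed.

(** With zero radical both weight vectors agree, and the weight vector already tells whether an
    element is zero. *)
Lemma Hpart_rad_key : H = preim_partition (@rad_key t n Rf) [set: Rp].
Proof.
rewrite HpartE; apply: eq_preim_partition => a b.
have wE (c : Rp) : wtbar_vec c = wt_vec c.
  apply/eqP; rewrite eq_count_vec; apply/forallP=> i; rewrite count_vecE.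
  by apply/eqP/eq_card => j; rewrite [LHS]inE [RHS]inE semisimple_rad.
rewrite /soc_key socT !inE (inj_eq Some_inj) xpair_eqE !wE.
by case: eqP => //= ab; rewrite -!wt_vec_eq0 ab eqxx.
Qed.

Lemma Hpart_prod_hamming : H = prod_hamming t n Rf.
Proof.
have PE m : Pblock t n Rf m =
    [set a : Rp | [forall i, a i \in [set x : Ri t n Rf i | wt t n Rf i x == m i]]].
  apply/setP=> a; rewrite [LHS]inE socT in_setT [RHS]inE.
  by apply: eq_forallb => i; rewrite inE.
have Pneq0 m : Pblock t n Rf m != set0.
  have [a ak] := soc_key_onto m; apply/set0Pn; exists a.
  by rewrite PblockE inE ak.
apply/setP=> B; rewrite in_setD1 in_setU1 /Pdiamond socT setCT.
apply/andP/imsetP => [[B0]|[f fP ->]].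
  rewrite (negPf B0) => /imsetP[m _ ->].
  exists [ffun i => [set x : Ri t n Rf i | wt t n Rf i x == m i]].
    by rewrite inE; apply/forallP=> i; rewrite ffunE imset_f.
  by rewrite PE; apply/setP=> a; rewrite !inE; apply: eq_forallb => i; rewrite ffunE.
have hf i : exists k : 'I_(n i).+1, f i == [set x : Ri t n Rf i | wt t n Rf i x == k].
  by move: fP; rewrite inE => /forallP/(_ i)/imsetP[k _ ->]; exists k.
(* A choice of one Hamming block in each factor amounts to a choice of one weight in each factor. *)
pose m : M := [ffun i => xchoose (hf i)].
have -> : [set a : Rp | [forall i, a i \in f i]] = Pblock t n Rf m.
  rewrite PE; apply/setP=> a; rewrite !inE; apply: eq_forallb => i.
  by rewrite (eqP (xchooseP (hf i))) /m ffunE.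
by rewrite Pneq0 imset_f ?orbT.
Qed.

End Semisimple.
End MainResults.

Unset Implicit Arguments.

Theorem theorem4p1
  (t : nat) (n : 'I_t -> nat)
  (Rf : forall i : 'I_t, 'I_(n i) -> finNzRingType)
  (q : 'I_t -> nat)
  (hn : forall i, (0 < n i)%N)
  (hloc : forall i j, local_ring (Rf i j))
  (hfrob : forall i j, frobenius (Rf i j))
  (hquot : forall i j, card_quot_rad (Rf i j) = q i)
  (hsoc : forall i j, #|soc (Rf i j)| = q i)
  (hq : injective q)
  (chi : Rprod t n Rf -> algC)
  (hchi : generating_char (Rprod t n Rf) (addR t n Rf) (mulR t n Rf) chi) :
  let H := Hpart t n Rf in
  let s := (\prod_(i < t) (n i).+1)%N in
  (forall chi' : Rprod t n Rf -> algC,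
         generating_char (Rprod t n Rf) (addR t n Rf) (mulR t n Rf) chi' ->
         rdual t n Rf chi' H = rdual t n Rf chi H) /\
      ldual t n Rf chi H = rdual t n Rf chi H /\
      rdual t n Rf chi H = Qpart t n Rf /\
      reflexive_part t n Rf chi H /\
      (socR t n Rf = [set: Rprod t n Rf] ->
        [/\ #|H| = s, H = prod_hamming t n Rf & self_dual t n Rf chi H]) /\
      (socR t n Rf != [set: Rprod t n Rf] -> #|H| = s.+1).
Proof.
move=> H s.
(* [Qpart] does not mention the character, so this also yields independence of [chi]. *)
have rdualE chi' : generating_char _ (addR t n Rf) (mulR t n Rf) chi' ->
    rdual t n Rf chi' H = Qpart t n Rf.
  by move=> gen; rewrite (QpartE hloc); exact: (rdual_HpartE hn hloc hquot hsoc gen).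
have cardH : #|H| = (s + (socR t n Rf != [set: Rprod t n Rf]))%N.
  exact: (card_Hpart hloc hquot hsoc).
split; first by move=> chi' gen; rewrite !rdualE.
split.
  by rewrite rdualE // (QpartE hloc); exact: (ldual_HpartE hn hloc hquot hsoc hchi).
split; first exact: rdualE.
split.
  by rewrite /reflexive_part rdualE //; exact: (ldual_QpartE hn hloc hquot hchi).
split=> [socT|nsocT]; last by rewrite cardH nsocT addn1.
split; first by rewrite cardH socT eqxx addn0.
- exact: (Hpart_prod_hamming hloc hquot hsoc socT).
- rewrite /self_dual rdualE // (QpartE hloc).
  exact: esym (Hpart_rad_key hloc socT).
Qed.
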